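(* Let $k=k(n)$ and $m=m(n)$ be functions of $n$. (i) Suppose that $\frac{k^2n}{m}=\log n+\omega$, where $\omega=\omega(n)\rightarrow\infty$ as $n\rightarrow\infty$. Then asymptotically almost surely $G(n,m,k)$ contains no isolated vertex. (ii) Suppose that $\frac{k^2n}{m}=\log n-\omega$, where $\omega=\omega(n)\rightarrow\infty$ as $n\rightarrow\infty$. Then asymptotically almost surely $G(n,m,k)$ contains an isolated vertex.
   Context: The uniform random intersection graph $G(n,m,k)$ (for positive integers $k\le m$) is the random graph on a set $V$ of $n$ nodes defined as follows: fix a set $M$ of $m$ colours; to each node $v\in V$ assign a subset $F_v\subseteq M$ of exactly $k$ distinct colours, chosen uniformly at random among all $k$-subsets of $M$, independently for different nodes; distinct nodes $u,v$ are joined by an edge if and only if $F_u\cap F_v\neq\emptyset$. An event holds asymptotically almost surely if its probability tends to $1$ as $n\rightarrow\infty$. Here $\log$ denotes the natural logarithm. *)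

(* Defs.v *)
From HB Require Import structures.
From mathcomp Require Import all_boot all_order all_algebra.
From mathcomp Require Import all_classical all_reals all_analysis.
Set Implicit Arguments. Unset Strict Implicit. Unset Printing Implicit Defensive.
Import Order.TTheory GRing.Theory Num.Theory.

(* An outcome of G(n,m,k): an assignment of a colour set F v ⊆ M = 'I_m
   to every node v ∈ V = 'I_n.  It is admissible when every F v has exactly
   k colours; the uniform random intersection graph is the uniform
   distribution on admissible assignments (= independent uniform k-subsets). *)
Definition colouring (n m : nat) := {ffun 'I_n -> {set 'I_m}}.

Definition admissible (n m k : nat) (F : colouring n m) : bool :=
  [forall v, #|F v| == k].

Definition adjacent (n m : nat) (F : colouring n m) (u v : 'I_n) : bool :=
  (u != v) && (F u :&: F v != finset.set0).

Definition isolated (n m : nat) (F : colouring n m) (v : 'I_n) : bool :=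
  [forall u, ~~ adjacent F u v].

Definition has_isolated (n m : nat) (F : colouring n m) : bool :=
  [exists v, isolated F v].

Definition prob_Gnmk (R : realType) (n m k : nat) (E : pred (colouring n m)) : R :=
  (#|[pred F : colouring n m | admissible k F && E F]|%:R / #|[pred F : colouring n m | admissible k F]|%:R)%R.
Arguments prob_Gnmk R n m k E : clear implicits.

(* Main.v *)
Require Import Defs.
From HB Require Import structures.
From mathcomp Require Import all_boot all_order all_algebra.
From mathcomp Require Import zify ring lra.
From mathcomp Require Import all_classical all_reals all_analysis.
Import Order.TTheory GRing.Theory Num.Theory.
Import numFieldTopology.Exports numFieldNormedType.Exports.

(* Let [q = 'C(m - k, k) / 'C(m, k)] be the probability that two independent colour sets
   are disjoint and [x = k^2 / m]; then [1 - x <= q <= expR (- x)].  The number [X] of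
   isolated nodes has mean [n q^(n-1)].  Above the threshold this is at most
   [n expR (- (n - 1) x) <= expR (1 - omega / 2)], which tends to 0.  Below it,
   [x <= 2 / sqrt n] gives [E X >= expR (omega - 8)], and the log-concavity
   ['C(m - 2k, k) 'C(m, k) <= 'C(m - k, k)^2] bounds the probability that two given nodes
   are both isolated by [q^(2n-3)], so that [E X^2 <= E X + (E X)^2 / q]; Chebyshev's
   inequality then yields [P(X = 0) <= 1 / E X + (1 / q - 1)], which tends to 0. *)

(** * Binomial inequalities behind the bounds on the disjointness probability *)

Section Binomials.
Local Open Scope nat_scope.

(** Multiplying by [k!] turns both binomials into falling factorials, which compare factor by
    factor: [(m - k - i) * m <= (m - k) * (m - i)]. *)
Lemma bin_subM_expn (m k : nat) :
  'C(m - k, k) * m ^ k <= (m - k) ^ k * 'C(m, k).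
Proof.
rewrite -(leq_pmul2r (fact_gt0 k)) mulnAC bin_ffact -mulnA bin_ffact.
have expE c : c ^ k = \prod_(i < k) c by rewrite prod_nat_const card_ord.
rewrite !ffact_prod !expE -!big_split /=.
by apply: leq_prod => i _; nia.
Qed.

(** After two factors [k!], this is [(m - 2k - i) * (m - i) <= (m - k - i) ^ 2] for each [i < k]. *)
Lemma bin_sub_log_concave (m k : nat) :
  'C(m - k.*2, k) * 'C(m, k) <= 'C(m - k, k) ^ 2.
Proof.
rewrite -(leq_pmul2r (fact_gt0 k)) -(leq_pmul2r (fact_gt0 k)).
have -> : forall a b c : nat, a * b * c * c = (a * c) * (b * c) by lia.
have -> : forall a c : nat, a ^ 2 * c * c = (a * c) * (a * c) by lia.
rewrite !bin_ffact !ffact_prod -!big_split /=.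
by apply: leq_prod => i _; nia.
Qed.

(** Union bound: a draw that meets a fixed [j]-set contains one of its elements, with ['C(m, k)]
    completions each. The induction uses Pascal's rule. *)
Lemma bin_le_sub (m k j : nat) : j <= m ->
  'C(m.+1, k.+1) <= 'C(m.+1 - j, k.+1) + j * 'C(m, k).
Proof.
elim: j => [|j IHj] ltjm; first by rewrite subn0 addn0.
apply: leq_trans (IHj (ltnW ltjm)) _.
have -> : m.+1 - j = (m.+1 - j.+1).+1 by lia.
rewrite binS mulSn -addnA leq_add2l leq_add2r.
by apply: leq_bin2l; lia.
Qed.

(** This becomes [1 - k^2 / m <= q] after division. It is the union bound over a [k]-set, combined
    with [m * 'C(m - 1, k - 1) = k * 'C(m, k)]. *)
Lemma bin_sub_union_bound (m k : nat) : 0 < k <= m ->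
  m * 'C(m, k) <= m * 'C(m - k, k) + k ^ 2 * 'C(m, k).
Proof.
case: k m => // k [|m] //= km.
have [/eqP e|ltkm] : (k == m) \/ k < m by lia.
  by rewrite e binn; nia.
have := bin_le_sub m k k.+1 ltkm; have := mul_bin_diag m.+1 k.
rewrite /=; nia.
Qed.

End Binomials.

(** * Counting assignments with one or two given isolated nodes *)

Section Counting.
Local Open Scope nat_scope.
Variables n m k : nat.

Lemma card_family_prod (I T : finType) (G : I -> pred T) :
  #|family G| = \prod_i #|G i|.
Proof. by rewrite card_family foldrE big_image. Qed.

Lemma card_disjoint_draws (T : finType) (D : {set T}) (j : nat) :
  #|[pred B : {set T} | (#|B| == j) && [disjoint B & D]]| = 'C(#|T| - #|D|, j).
Proof.
have -> : #|T| - #|D| = #|~: D| by have := cardsC D; lia.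
rewrite -cards_draws -cardsE; apply: eq_card => B.
by rewrite !inE andbC finset.disjoints_subset.
Qed.

(** The common count: with the colours on [S] fixed, the other nodes choose independently outside
    [D]. It is used with zero, one and two fixed nodes. *)
Lemma card_prescribed (S : {set 'I_n}) (F0 : colouring n m) (D : {set 'I_m}) :
  #|[pred F : colouring n m | [forall u, if u \in S then F u == F0 u
       else (#|F u| == k) && [disjoint F u & D]]]|
  = 'C(m - #|D|, k) ^ (n - #|S|).
Proof.
pose G u : pred {set 'I_m} := if u \in S then pred1 (F0 u) else
  [pred B : {set 'I_m} | (#|B| == k) && [disjoint B & D]].
transitivity #|family G|.
  apply: eq_card => F; rewrite inE; apply/forallP/familyP => H u;
  by move: (H u); rewrite /G; case: ifP.
rewrite card_family_prod (bigID (mem S)) /= big1 ?mul1n; last first.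
  by move=> u uS; rewrite /G uS card1.
rewrite (eq_bigr (fun=> 'C(m - #|D|, k))); last first.
  by move=> u /negbTE uS; rewrite /G uS card_disjoint_draws card_ord.
rewrite prod_nat_const; congr (_ ^ _).
have <- : #|~: S| = n - #|S| by rewrite cardsCs card_ord finset.setCK.
by apply: eq_card => u; rewrite !inE.
Qed.

Lemma card_admissible : #|[pred F : colouring n m | admissible k F]| = 'C(m, k) ^ n.
Proof.
have := card_prescribed finset.set0 [ffun=> finset.set0] finset.set0.
rewrite !cards0 !subn0 => <-; apply: eq_card => F; rewrite !inE.
by apply: eq_forallb => u; rewrite inE finset.disjoints_subset finset.setC0 finset.subsetT andbT.
Qed.

Lemma isolatedP (F : colouring n m) (v : 'I_n) :
  reflect (forall u : 'I_n, u != v -> [disjoint F u & F v]) (Defs.isolated F v).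
Proof.
apply: (iffP forallP) => H u.
  by move=> uv; have := H u; rewrite /Defs.adjacent uv negbK finset.setI_eq0.
rewrite /Defs.adjacent; case: (eqVneq u v) => //= uv.
by rewrite negbK finset.setI_eq0; apply: H.
Qed.

Lemma card_isolated (v : 'I_n) :
  #|[pred F : colouring n m | admissible k F && Defs.isolated F v]|
  = 'C(m, k) * 'C(m - k, k) ^ n.-1.
Proof.
rewrite -sum1_card.
(* Conditioning on [F v = A], isolation of [v] says that every other node avoids [A]. *)
rewrite (partition_big (fun F : colouring n m => F v) (fun A => #|A| == k)); last first.
  by move=> F; rewrite inE => /andP[/forallP/(_ v)].
rewrite (eq_bigr (fun=> 'C(m - k, k) ^ n.-1)) => [|A /eqP cA].
  rewrite sum_nat_const; congr (_ * _).
  by have := card_draws 'I_m k; rewrite card_ord => <-; rewrite cardsE.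
have := card_prescribed [set v]%SET [ffun=> A] A.
rewrite sum1_card cA cards1 subn1 => <-.
apply: eq_card => F; rewrite unfold_in /= !inE; apply/idP/idP.
  case/andP=> /andP[/forallP Fk /isolatedP Fv] /eqP FvA.
  apply/forallP => u; rewrite inE ffunE; case: eqVneq => [->|uv]; first exact/eqP.
  by rewrite Fk -FvA Fv.
move/forallP => H.
have FvA : (F : colouring n m) v = A by have := H v; rewrite inE eqxx ffunE => /eqP.
rewrite FvA eqxx andbT; apply/andP; split.
  apply/forallP => u; have := H u; rewrite inE.
  by case: eqVneq => [->|_ /andP[]//]; rewrite FvA cA.
apply/isolatedP => u uv; have := H u.
by rewrite inE (negbTE uv) FvA => /andP[].
Qed.

Lemma disjoint_setUr (T : finType) (A B C : {set T}) :
  [disjoint C & A :|: B] = [disjoint C & A] && [disjoint C & B].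
Proof. by rewrite -!finset.setI_eq0 finset.setIUr finset.setU_eq0. Qed.

Lemma card_isolated_pair (u v : 'I_n) : u != v ->
  #|[pred F : colouring n m | [&& admissible k F, Defs.isolated F u & Defs.isolated F v]]|
  = 'C(m, k) * 'C(m - k, k) * 'C(m - k.*2, k) ^ n.-2.
Proof.
move=> uv; have vu : v != u by rewrite eq_sym.
rewrite -sum1_card.
(* Once the two colour sets are fixed, necessarily disjoint, every other node avoids their union,
   which has [2k] colours. *)
rewrite (partition_big (fun F : colouring n m => (F u, F v))
  (fun p => (#|p.1| == k) && ((#|p.2| == k) && [disjoint p.2 & p.1]))); last first.
  move=> F; rewrite inE => /and3P[/forallP Fk /isolatedP Fu _] /=.
  by rewrite !Fk Fu.
rewrite (eq_bigr (fun=> 'C(m - k.*2, k) ^ n.-2)) => [|[A B] /= /and3P[/eqP cA /eqP cB dBA]].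
  rewrite sum_nat_const; congr (_ * _).
  rewrite -sum1_card.
  have := @pair_big_dep _ 0 addn _ _ (fun A : {set 'I_m} => #|A| == k)
    (fun A B : {set 'I_m} => (#|B| == k) && [disjoint B & A]) (fun _ _ => 1).
  move=> /= <-.
  rewrite (eq_bigr (fun=> 'C(m - k, k))) => [|A /eqP cA].
    rewrite sum_nat_const; congr (_ * _).
    by have := card_draws 'I_m k; rewrite card_ord => <-; rewrite cardsE.
  by rewrite sum1_card card_disjoint_draws card_ord cA.
have cAB : #|A :|: B| = k.*2.
  by rewrite cardsU finset.setIC (eqP (_ : B :&: A == finset.set0)) ?finset.setI_eq0 // cards0 cA cB subn0 addnn.
have cuv : #|[set u; v]%SET| = 2 by rewrite cards2 uv.
have := card_prescribed [set u; v]%SET [ffun w => if w == u then A else B] (A :|: B).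
rewrite sum1_card cAB cuv subn2 => <-.
apply: eq_card => F; rewrite unfold_in /= !inE; apply/idP/idP.
  case/andP=> /and3P[/forallP Fk /isolatedP Fu /isolatedP Fv] /eqP[FuA FvB].
  apply/forallP => w; rewrite !inE ffunE.
  case: (eqVneq w u) => [->|wu] /=; first exact/eqP.
  case: (eqVneq w v) => [->|wv] /=; first exact/eqP.
  by rewrite Fk disjoint_setUr -FuA -FvB Fu ?Fv.
move/forallP => H.
have FuA : (F : colouring n m) u = A by have := H u; rewrite !inE eqxx ffunE eqxx => /eqP.
have FvB : (F : colouring n m) v = B.
  by have := H v; rewrite !inE eqxx orbT ffunE (negbTE vu) => /eqP.
have Hw w : w != u -> w != v -> let C := (F : colouring n m) w in [&& #|C| == k, [disjoint C & A] & [disjoint C & B]].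
  move=> wu wv; have := H w; rewrite !inE (negbTE wu) (negbTE wv) /= => /andP[-> /=].
  by rewrite disjoint_setUr.
rewrite FuA FvB eqxx andbT; apply/and3P; split.
- apply/forallP => w; case: (eqVneq w u) => [->|wu]; first by rewrite FuA cA.
  case: (eqVneq w v) => [->|wv]; first by rewrite FvB cB.
  by have /and3P[] := Hw w wu wv.
- apply/isolatedP => w wu; rewrite FuA; case: (eqVneq w v) => [->|wv]; first by rewrite FvB.
  by have /and3P[] := Hw w wu wv.
- apply/isolatedP => w wv; rewrite FvB; case: (eqVneq w u) => [->|wu].
    by rewrite FuA disjoint_sym.
  by have /and3P[] := Hw w wu wv.
Qed.

End Counting.

Local Open Scope ring_scope.

(** * First and second moments of the number of isolated nodes *)

Section Moments.
Variables (R : realType) (n m k : nat).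
Hypothesis le_km : (k <= m)%N.

Definition disjoint_prob : R := 'C(m - k, k)%:R / 'C(m, k)%:R.
Local Notation q := disjoint_prob.

Definition nb_isolated (F : colouring n m) : R := \sum_v (Defs.isolated F v)%:R.

Let b0_gt0 : 0 < 'C(m, k)%:R :> R.
Proof. by rewrite ltr0n bin_gt0. Qed.

Let N_gt0 : 0 < 'C(m, k)%:R ^+ n :> R.
Proof. exact: exprn_gt0. Qed.

Lemma disjoint_prob_ge0 : 0 <= q.
Proof. by rewrite divr_ge0. Qed.

Lemma prob_GnmkE (E : pred (colouring n m)) :
  prob_Gnmk R n m k E =
  (\sum_(F : colouring n m | admissible k F) (E F)%:R) / 'C(m, k)%:R ^+ n.
Proof.
rewrite /prob_Gnmk card_admissible natrX -sum1_card natr_sum big_mkcondr /=.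
by congr (_ / _); apply: eq_bigr => F _; case: (E F).
Qed.

Lemma prob_GnmkC (E : pred (colouring n m)) :
  prob_Gnmk R n m k (fun F => ~~ E F) = 1 - prob_Gnmk R n m k E.
Proof.
rewrite !prob_GnmkE; apply/eqP; rewrite eq_sym subr_eq -mulrDl -big_split /=.
rewrite (eq_bigr (fun=> 1)) => [|F _]; last by case: (E F); rewrite ?addr0 ?add0r.
by rewrite sumr_const card_admissible natrX divff ?lt0r_neq0.
Qed.

Lemma prob_Gnmk_le1 (E : pred (colouring n m)) : prob_Gnmk R n m k E <= 1.
Proof.
have : 0 <= prob_Gnmk R n m k (fun F => ~~ E F) by rewrite /prob_Gnmk divr_ge0.
by rewrite prob_GnmkC subr_ge0.
Qed.

Lemma sum_isolated (v : 'I_n) :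
  \sum_(F : colouring n m | admissible k F) (Defs.isolated F v)%:R
  = 'C(m, k)%:R ^+ n * q ^+ n.-1 :> R.
Proof.
have := card_isolated n m k v; rewrite -sum1_card big_mkcondr /=.
move=> /(congr1 (fun i : nat => i%:R : R)); rewrite natr_sum => E.
transitivity ('C(m, k)%:R * 'C(m - k, k)%:R ^+ n.-1 : R).
  rewrite -natrX -natrM -E; apply: eq_bigr => F _; by case: (Defs.isolated F v).
have -> : 'C(m, k)%:R ^+ n = 'C(m, k)%:R * 'C(m, k)%:R ^+ n.-1 :> R.
  by rewrite -exprS prednK //; have := ltn_ord v; lia.
by rewrite -mulrA -exprMn [_ * q]mulrC /disjoint_prob divfK ?lt0r_neq0.
Qed.

(** The two nodes are disjoint with probability [q]; each of the other [n - 2] avoids both with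
    probability ['C(m - 2k, k) / 'C(m, k)], at most [q ^+ 2] by log-concavity. *)
Lemma sum_isolated_pair (u v : 'I_n) : u != v ->
  \sum_(F : colouring n m | admissible k F)
     (Defs.isolated F u)%:R * (Defs.isolated F v)%:R
  <= 'C(m, k)%:R ^+ n * (q * (q ^+ 2) ^+ n.-2) :> R.
Proof.
move=> uv.
have := card_isolated_pair n m k u v uv; rewrite -sum1_card big_mkcondr /=.
move=> /(congr1 (fun i : nat => i%:R : R)); rewrite natr_sum => E.
rewrite (_ : \sum_(F | _) _ = 'C(m, k)%:R * 'C(m - k, k)%:R * 'C(m - k.*2, k)%:R ^+ n.-2);
  last first.
  rewrite -natrX -!natrM -E; apply: eq_bigr => F _.
  by case: (Defs.isolated F u) (Defs.isolated F v) => [] [] /=; rewrite ?mulr0 ?mul0r ?mulr1.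
have -> : 'C(m, k)%:R ^+ n = 'C(m, k)%:R ^+ 2 * 'C(m, k)%:R ^+ n.-2 :> R.
  rewrite -exprD; congr (_ ^+ _).
  by move: uv (ltn_ord u) (ltn_ord v); rewrite -val_eqE /=; lia.
rewrite mulrACA -exprMn; apply: ler_pM; rewrite ?exprn_ge0 ?mulr_ge0 //.
  by rewrite expr2 -mulrA (mulrC _ q) /disjoint_prob divfK ?lt0r_neq0.
apply: lerXn2r; rewrite ?nnegrE ?mulr_ge0 ?exprn_ge0 ?disjoint_prob_ge0 //.
have -> : 'C(m, k)%:R * q ^+ 2 = 'C(m - k, k)%:R ^+ 2 / 'C(m, k)%:R.
  by rewrite /disjoint_prob; field; rewrite lt0r_neq0.
by rewrite ler_pdivlMr // -natrX -natrM ler_nat bin_sub_log_concave.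
Qed.

Lemma has_isolated_le (F : colouring n m) : (has_isolated F)%:R <= nb_isolated F.
Proof.
rewrite /nb_isolated; case: (boolP (has_isolated F)) => [/existsP[v Fv]|_].
  by rewrite (bigD1 v) //= Fv lerDl sumr_ge0.
by rewrite sumr_ge0.
Qed.

Lemma sum_nb_isolated :
  \sum_(F : colouring n m | admissible k F) nb_isolated F
  = 'C(m, k)%:R ^+ n * (n%:R * q ^+ n.-1).
Proof.
rewrite exchange_big /= (eq_bigr (fun=> 'C(m, k)%:R ^+ n * q ^+ n.-1)).
  by rewrite sumr_const card_ord -[LHS]mulr_natl mulrCA.
by move=> v _; exact: sum_isolated.
Qed.

Lemma prob_has_isolated_le :
  prob_Gnmk R n m k (fun F => has_isolated F) <= n%:R * q ^+ n.-1.
Proof.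
rewrite prob_GnmkE ler_pdivrMr // mulrC -sum_nb_isolated.
by apply: ler_sum => F _; exact: has_isolated_le.
Qed.

(** The square expands over ordered pairs of nodes. Diagonal terms are idempotent indicators and
    return the first moment; the fewer than [n ^ 2] others satisfy the pair bound. *)
Lemma sum_nb_isolated_sqr :
  \sum_(F : colouring n m | admissible k F) nb_isolated F ^+ 2
  <= 'C(m, k)%:R ^+ n * (n%:R * q ^+ n.-1 + n%:R ^+ 2 * (q * (q ^+ 2) ^+ n.-2)).
Proof.
rewrite mulrDr -sum_nb_isolated.
under eq_bigr do rewrite expr2 /nb_isolated mulr_suml.
rewrite exchange_big [X in _ <= X + _]exchange_big /=.
have -> : 'C(m, k)%:R ^+ n * (n%:R ^+ 2 * (q * (q ^+ 2) ^+ n.-2))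
  = \sum_(u : 'I_n) n%:R * ('C(m, k)%:R ^+ n * (q * (q ^+ 2) ^+ n.-2)).
  by rewrite sumr_const card_ord -[RHS]mulr_natl; ring.
rewrite -big_split /=; apply: ler_sum => u _.
under eq_bigr do rewrite mulr_sumr.
rewrite exchange_big /= (bigD1 u) //=; apply: lerD.
  by apply: ler_sum => F _; case: (Defs.isolated F u); rewrite ?mulr1 ?mulr0.
have c_ge0 : 0 <= 'C(m, k)%:R ^+ n * (q * (q ^+ 2) ^+ n.-2).
  by rewrite !mulr_ge0 ?exprn_ge0 ?disjoint_prob_ge0.
apply: (@le_trans _ _ (\sum_(v : 'I_n | v != u) ('C(m, k)%:R ^+ n * (q * (q ^+ 2) ^+ n.-2)))).
  by apply: ler_sum => v vu; apply: sum_isolated_pair; rewrite // eq_sym.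
rewrite sumr_const -[X in X <= _]mulr_natl; apply: ler_wpM2r => //.
by rewrite ler_nat -[X in (_ <= X)%N]card_ord max_card.
Qed.

(* Chebyshev's inequality: an outcome without isolated node contributes the square of
   the mean to the variance. *)
Lemma prob_no_isolated_le : (1 < n)%N -> 0 < q ->
  prob_Gnmk R n m k (fun F => ~~ has_isolated F)
  <= (n%:R * q ^+ n.-1)^-1 + (q^-1 - 1).
Proof.
move=> n1 q0; set c := n%:R * q ^+ n.-1.
have c0 : 0 < c by rewrite mulr_gt0 ?exprn_gt0 // ltr0n; lia.
rewrite prob_GnmkE ler_pdivrMr //.
rewrite -(@ler_pM2r _ (c ^+ 2)) ?exprn_gt0 // mulr_suml.
apply: (@le_trans _ _ (\sum_(F : colouring n m | admissible k F) (nb_isolated F - c) ^+ 2)).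
  apply: ler_sum => F _; case: (boolP (has_isolated F)) => [_|].
    by rewrite mul0r sqr_ge0.
  move=> /existsPn Fv; rewrite /nb_isolated big1 => [|v _].
    by rewrite mul1r sub0r sqrrN.
  by rewrite (negbTE (Fv v)).
(* Since [c] is the mean, the cross term is twice the constant term with opposite sign. *)
have -> : \sum_(F : colouring n m | admissible k F) (nb_isolated F - c) ^+ 2 =
  \sum_(F : colouring n m | admissible k F) nb_isolated F ^+ 2
  - c ^+ 2 * 'C(m, k)%:R ^+ n.
  under eq_bigr do rewrite sqrrB.
  rewrite big_split /= sumrB.
  under [X in _ - X + _]eq_bigr do rewrite -mulrnAr.
  rewrite -mulr_suml sum_nb_isolated -/c sumr_const card_admissible.
  by rewrite -[c ^+ 2 *+ _]mulr_natl natrX -mulr_natl; ring.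
rewrite lerBlDr (le_trans sum_nb_isolated_sqr) // -/c.
(* The exponent [1 + 2(n - 2)] is one less than [2(n - 1)], whence the factor [1 / q]. *)
have -> : n%:R ^+ 2 * (q * (q ^+ 2) ^+ n.-2) = c ^+ 2 / q.
  have -> : c = n%:R * (q * q ^+ n.-2).
    by rewrite /c -exprS; congr (_ * _ ^+ _); lia.
  by rewrite exprAC; field; rewrite gt_eqF.
have -> : (c^-1 + (q^-1 - 1)) * 'C(m, k)%:R ^+ n * c ^+ 2 + c ^+ 2 * 'C(m, k)%:R ^+ n
  = 'C(m, k)%:R ^+ n * (c + c ^+ 2 / q).
  by field; rewrite !gt_eqF.
by [].
Qed.

(** The intermediate bound is [(1 - k / m) ^+ k], followed by [1 - y <= expR (- y)]. *)
Lemma disjoint_prob_le_expR : (0 < k)%N -> q <= expR (- (k%:R ^+ 2 / m%:R)).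
Proof.
move=> k0; have m0 : 0 < m%:R :> R by rewrite ltr0n; lia.
apply: (@le_trans _ _ ((1 - k%:R / m%:R) ^+ k)).
  have -> : 1 - k%:R / m%:R = (m - k)%:R / m%:R :> R.
    by rewrite natrB // mulrBl divff ?lt0r_neq0.
  rewrite expr_div_n ler_pdivrMr // mulrAC ler_pdivlMr ?exprn_gt0 //.
  by rewrite -!natrX -!natrM ler_nat bin_subM_expn.
have -> : - (k%:R ^+ 2 / m%:R) = k%:R * (- (k%:R / m%:R)) :> R by rewrite expr2 mulrN mulrA.
rewrite expRM_natl; apply: lerXn2r; rewrite ?nnegrE ?expR_ge0 ?expR_ge1Dx //.
by rewrite subr_ge0 ler_pdivrMr // mul1r ler_nat.
Qed.

Lemma disjoint_prob_ge : (0 < k)%N -> 1 - k%:R ^+ 2 / m%:R <= q.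
Proof.
move=> k0; have m0 : 0 < m%:R :> R by rewrite ltr0n; lia.
rewrite /disjoint_prob ler_pdivlMr // -(ler_pM2l m0).
have -> : m%:R * ((1 - k%:R ^+ 2 / m%:R) * 'C(m, k)%:R)
  = m%:R * 'C(m, k)%:R - k%:R ^+ 2 * 'C(m, k)%:R :> R by field; rewrite gt_eqF.
rewrite lerBlDr -natrX -!natrM -natrD ler_nat.
by apply: bin_sub_union_bound; rewrite k0.
Qed.

End Moments.

(** * Explicit probability bounds on both sides of the threshold *)

Section Estimates.
Variables (R : realType) (n m k : nat) (w : R).
Hypotheses (k_gt0 : (0 < k)%N) (le_km : (k <= m)%N) (w_ge0 : 0 <= w).

Lemma prob_no_isolated_ge : (1 < n)%N ->
  k%:R ^+ 2 * n%:R / m%:R = ln (n%:R : R) + w ->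
  1 - expR (1 - w / 2) <= prob_Gnmk R n m k (fun F => ~~ has_isolated F).
Proof.
move=> n_gt1 hw; rewrite prob_GnmkC // lerD2l lerN2.
apply: (le_trans (prob_has_isolated_le R n m k le_km)).
have n0 : 0 < n%:R :> R by rewrite ltr0n; lia.
set x : R := k%:R ^+ 2 / m%:R.
have xn : x * n%:R = ln n%:R + w by rewrite -hw /x mulrAC.
apply: (@le_trans _ _ (n%:R * expR (n.-1%:R * - x))).
  apply: ler_wpM2l => //; rewrite expRM_natl; apply: lerXn2r.
  - by rewrite nnegrE disjoint_prob_ge0.
  - by rewrite nnegrE expR_ge0.
  - exact: disjoint_prob_le_expR.
rewrite -{1}(@lnK _ n%:R) // -expRD ler_expR.
have -> : n.-1%:R = n%:R - 1 :> R by rewrite -subn1 natrB //; lia.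
have n2 : 2 <= n%:R :> R by rewrite ler_nat.
(* The exponent [ln n - (n - 1) * x] equals [x - w], so this bound on [x] suffices. It follows from
   [ln n < n] and [w <= w * n / 2]. *)
have x_le : x <= 1 + w / 2.
  rewrite -(ler_pM2r n0) xn; have := ln_sublinear n0.
  have : 0 <= w * (n%:R - 2) by rewrite mulr_ge0 // subr_ge0.
  lra.
lra.
Qed.

Lemma prob_has_isolated_ge : (16 <= n)%N ->
  k%:R ^+ 2 * n%:R / m%:R = ln (n%:R : R) - w ->
  1 - (expR (8 - w) + 4 / Num.sqrt n%:R) <= prob_Gnmk R n m k (fun F => has_isolated F).
Proof.
move=> n_ge hw.
have n0 : 0 < n%:R :> R by rewrite ltr0n; lia.
have -> : prob_Gnmk R n m k (fun F => has_isolated F)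
  = 1 - prob_Gnmk R n m k (fun F => ~~ has_isolated F).
  by rewrite prob_GnmkC // opprB addrCA subrr addr0.
rewrite lerD2l lerN2.
set x : R := k%:R ^+ 2 / m%:R.
have xn : x * n%:R = ln n%:R - w by rewrite -hw /x mulrAC.
have x0 : 0 <= x by rewrite divr_ge0 ?exprn_ge0.
set s : R := Num.sqrt n%:R.
have s2 : s ^+ 2 = n%:R by rewrite sqr_sqrtr ?ltW.
have s4 : 4 <= s.
  have n16 : 16 <= n%:R :> R by rewrite ler_nat.
  have := sqrtr_ge0 (n%:R : R); rewrite -/s => s_ge0; rewrite leNgt; apply/negP => s_lt4; nra.
have s0 : 0 < s by lra.
(* Here [x * s ^+ 2 = ln n - w], and [ln n = 2 * ln s <= 2 * s]. *)
have xs : x * s <= 2.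
  rewrite -(ler_pM2r s0) -mulrA -expr2 s2 xn.
  have : ln (n%:R : R) <= 2 * s.
    by have := ln_sublinear s0; rewrite -s2 lnXn // (mulr2n (ln s)); lra.
  by apply: le_trans; rewrite lerBlDr lerDl.
have x_le : x <= 2 / s by rewrite ler_pdivlMr.
have x_half : x <= 1 / 2.
  apply: (le_trans x_le); rewrite ler_pdivrMr //; lra.
have q_ge : 1 - x <= disjoint_prob R m k by exact: disjoint_prob_ge.
have q0 : 0 < disjoint_prob R m k by lra.
have q1 : disjoint_prob R m k <= 1.
  by rewrite /disjoint_prob ler_pdivrMr ?mul1r ?ltr0n ?bin_gt0 // ler_nat leq_bin2l ?leq_subr.
apply: (le_trans (prob_no_isolated_le R n m k le_km _ q0)); first by lia.
apply: lerD.
  rewrite -[X in _ <= expR X]opprB expRN lef_pV2 ?posrE ?expR_gt0 //; last first.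
    by rewrite mulr_gt0 // exprn_gt0.
  (* The exponent is [w - 2 * n * x ^+ 2], and [n * x ^+ 2 = (x * s) ^+ 2 <= 4] explains the
     constant 8. *)
  apply: (@le_trans _ _ (n%:R * expR (n%:R * - (x + 2 * x ^+ 2)))).
    rewrite -{1}(@lnK _ n%:R) // -expRD ler_expR.
    have : x ^+ 2 * n%:R <= 4.
      have xs0 : 0 <= x * s by rewrite mulr_ge0 // ltW.
      by rewrite -s2 -exprMn; move: (x * s) xs xs0 => y y2 y0; nra.
    lra.
  rewrite ler_pM2l // expRM_natl.
  apply: (@le_trans _ _ (disjoint_prob R m k ^+ n)).
    apply: lerXn2r; rewrite ?nnegrE ?expR_ge0 ?(ltW q0) //.
    apply: le_trans q_ge.
    (* For [0 <= x <= 1 / 2], [(1 - x) * (1 + x + 2 * x ^+ 2) = 1 + x ^+ 2 * (1 - 2 * x) >= 1], so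
       [expR (- (x + 2 * x ^+ 2)) <= 1 - x]. *)
    have y0 : 0 < 1 + (x + 2 * x ^+ 2) by nra.
    rewrite expRN; apply: (@le_trans _ _ (1 + (x + 2 * x ^+ 2))^-1).
      by rewrite lef_pV2 ?posrE ?expR_gt0 ?expR_ge1Dx.
    rewrite -[X in X <= _]mul1r ler_pdivrMr //; nra.
  apply: ler_wiXn2l => //; [exact: ltW | lia].
have -> : 4 / s = 2 * (2 / s) by field; rewrite gt_eqF.
apply: (@le_trans _ _ (2 * x)); last by rewrite ler_pM2l.
(* [1 / q <= 1 + 2 * x] because [(1 + 2 * x) * (1 - x) = 1 + x * (1 - 2 * x) >= 1]. *)
rewrite lerBlDr -[X in X <= _]mul1r ler_pdivrMr //.
nra.
Qed.

End Estimates.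

(** * Passage to the limit *)

Local Open Scope classical_set_scope.
Local Open Scope ring_scope.

Theorem theorem2 (R : realType) (k m : nat -> nat) (omega : R^nat)
  (hk : forall n, (1 <= k n)%N) (hkm : forall n, (k n <= m n)%N)
  (homega : omega @ \oo --> +oo%R) :
  ((forall n : nat,
      (k n)%:R ^+ 2 * n%:R / (m n)%:R = ln (n%:R : R) + omega n) ->
   (prob_Gnmk R n (m n) (k n) (fun F => ~~ has_isolated F)
     @[n --> \oo] --> (1 : R)))
  /\
  ((forall n : nat,
      (k n)%:R ^+ 2 * n%:R / (m n)%:R = ln (n%:R : R) - omega n) ->
   (prob_Gnmk R n (m n) (k n) (fun F => has_isolated F)
     @[n --> \oo] --> (1 : R))).
Proof.
have omega_ge A : \forall n \near \oo, A <= omega n by move/cvgryPge: homega; apply.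
split=> h; apply/cvgrPdist_le => e e0; near=> n.
- rewrite ger0_norm ?subr_ge0 ?prob_Gnmk_le1 // lerBlDr -lerBlDl.
  have w0 : 0 <= omega n by near: n.
  have n1 : (1 < n)%N by near: n; exists 2%N.
  apply: le_trans (prob_no_isolated_ge R n (m n) (k n) (omega n) (hk n) (hkm n) w0 n1 (h n)).
  rewrite lerD2l lerN2 -[leRHS]lnK // ler_expR.
  have : 2 * (1 - ln e) <= omega n by near: n.
  lra.
- rewrite ger0_norm ?subr_ge0 ?prob_Gnmk_le1 // lerBlDr -lerBlDl.
  have w0 : 0 <= omega n by near: n.
  have n16 : (16 <= n)%N by near: n; exists 16%N.
  apply: le_trans (prob_has_isolated_ge R n (m n) (k n) (omega n) (hk n) (hkm n) w0 n16 (h n)).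
  have e20 : 0 < e / 2 by lra.
  (* Each error term gets [e / 2]: the exponential needs [omega n >= 8 - ln (e / 2)], the other term
     needs [n >= (4 / (e / 2)) ^+ 2]. *)
  rewrite lerD2l lerN2 [e in leRHS]splitr; apply: lerD.
    rewrite -[leRHS]lnK // ler_expR.
    have : 8 - ln (e / 2) <= omega n by near: n.
    lra.
  rewrite ler_pdivrMr ?sqrtr_gt0 ?ltr0n; last by lia.
  rewrite mulrC -ler_pdivrMr // -[leLHS]ger0_norm; last by rewrite divr_ge0 // ltW.
  rewrite -sqrtr_sqr ler_sqrt //.
  near: n; exact: nbhs_infty_ger.
Unshelve. all: end_near.
Qed.
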